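(* Let $q$ be a prime power, $n\ge2$, $s\ge2$, $1\le k\le n-1$ integers, $\sigma$ a generator of $\mathrm{Gal}(\mathbb F_{q^n}/\mathbb F_q)$, and $F\in\mathbb F_q[Y]$ a monic irreducible polynomial of degree $s$. If $(n,s,F)\ne(2,2,Y^2-\nu)$ for every $\nu\in\mathbb F_q^\times$, then $$\mathrm{Aut}_{\mathbb E_F}(\mathcal S_k(F))=\mathcal A_F.$$
   Context: $R=\mathbb F_{q^n}[X;\sigma]$ is the skew polynomial ring with $X\alpha=\sigma(\alpha)X$; its center is $\mathbb F_q[X^n]$. $RF(X^n)$ is a two-sided ideal, $R_F:=R/RF(X^n)$, and $\mathbb E_F:=Z(R_F)$ is the image of $\mathbb F_q[X^n]$, a field isomorphic to $\mathbb F_q[Y]/(F)\cong\mathbb F_{q^s}$; $R_F\cong M_n(\mathbb E_F)$ as $\mathbb E_F$-algebras. Elements of $\mathbb F_{q^n}$ and $X$ are identified with their classes in $R_F$ ($X$ is a unit of $R_F$). The code is $$\mathcal S_k(F):=\Big\{\sum_{i=0}^{sk-1}\alpha_iX^i+RF(X^n):\alpha_i\in\mathbb F_{q^n}\Big\}\subseteq R_F .$$ Under $R_F\cong M_n(\mathbb E_F)$, its linear automorphism group is $$\mathrm{Aut}_{\mathbb E_F}(\mathcal S_k(F)):=\{(\bar g,\bar h)\in R_F^\times\times R_F^\times:\ \bar g\,\mathcal S_k(F)\,\bar h=\mathcal S_k(F)\}.$$ Finally, $$\mathcal G_F:=\{\bar c\,\gamma X^t:\ \bar c\in\mathbb E_F^\times,\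 \gamma\in\mathbb F_{q^n}^\times,\ t\in\{0,\dots,n-1\}\},\qquad \mathcal A_F:=\{(\bar g,\bar g^{-1}\lambda):\ \bar g\in\mathcal G_F,\ \lambda\in\mathbb F_{q^n}^\times\}.$$ *)

(* Defs.v *)
From HB Require Import structures.
From mathcomp Require Import all_boot all_fingroup all_algebra all_solvable all_field.
From mathcomp Require Import ring_quotient generic_quotient.
From mathcomp Require Import boolp classical_sets.

Set Implicit Arguments.
Unset Strict Implicit.
Unset Printing Implicit Defensive.

Import GRing.Theory.
Local Open Scope ring_scope.
Local Open Scope quotient_scope.
Local Open Scope classical_set_scope.

Section SkewPoly.
Variables (A : nzRingType) (s : {rmorphism A -> A}).

Definition twist (n : nat) : A -> A := iter n s.
Arguments twist n a : simpl never.

Fact twist_is_zmod_morphism n : zmod_morphism (twist n).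
Proof. by move=> x y; rewrite /twist; elim: n => //= n ->; rewrite rmorphB. Qed.

Fact twist_is_monoid_morphism n : monoid_morphism (twist n).
Proof.
rewrite /twist; split; first by elim: n => //= n ->; rewrite rmorph1.
by move=> x y; elim: n => //= n ->; rewrite rmorphM.
Qed.

HB.instance Definition _ n :=
  GRing.isZmodMorphism.Build A A (twist n) (twist_is_zmod_morphism n).
HB.instance Definition _ n :=
  GRing.isMonoidMorphism.Build A A (twist n) (twist_is_monoid_morphism n).

Lemma twistD m n a : twist (m + n) a = twist m (twist n a).
Proof. by rewrite /twist iterD. Qed.

(* A[X; s]: the additive group of {poly A} (left coefficients: p stands for   *)
(* \sum_i p`_i X^i) with the product determined by X a = s(a) X.              *)
Definition skew_poly (_ : {rmorphism A -> A}) : Type := {poly A}.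

Local Notation R := (skew_poly s).

HB.instance Definition _ := GRing.Zmodule.on R.

Implicit Types p q r : R.

Definition skew_mul p q : R :=
  \poly_(i < (size (p : {poly A}) + size (q : {poly A})).-1)
     (\sum_(j < i.+1) p`_j * twist j q`_(i - j)).

Fact coef_skew_mul p q i :
  (skew_mul p q)`_i = \sum_(j < i.+1) p`_j * twist j q`_(i - j).
Proof.
rewrite coef_poly ltn_predRL; case: leqP => // le_pq_i1.
rewrite big1 // => j _; have [lq_p_j|lt_j_p] := leqP (size (p : {poly A})) j.
  by rewrite nth_default ?mul0r.
rewrite [q`__]nth_default ?rmorph0 ?mulr0 // leq_subRL -ltnS //.
by rewrite (leq_trans _ le_pq_i1) // ltn_add2r.
Qed.

Fact coef_skew_mul_rev p q i :
  (skew_mul p q)`_i = \sum_(j < i.+1) p`_(i - j) * twist (i - j) q`_j.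
Proof.
rewrite coef_skew_mul (reindex_inj rev_ord_inj) /=.
by apply: eq_bigr => j _; rewrite (sub_ordK j).
Qed.

Fact skew_mulA : associative skew_mul.
Proof.
move=> p q r; apply/polyP=> i; rewrite coef_skew_mul coef_skew_mul_rev.
pose coef3 j k := p`_j * (twist j q`_(i - j - k) * twist (i - k) r`_k).
transitivity (\sum_(j < i.+1) \sum_(k < i.+1 | (k <= i - j)%N) coef3 j k).
  apply: eq_bigr => /= j _; rewrite coef_skew_mul_rev rmorph_sum big_distrr /=.
  rewrite (big_ord_narrow_leq (leq_subr _ _)); apply: eq_bigr => k _ /=.
  rewrite /coef3 rmorphM /= -twistD addnBA -1?ltnS // subnKC //.
  by rewrite -ltnS.
rewrite (exchange_big_dep predT) //=; apply: eq_bigr => k _.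
transitivity (\sum_(j < i.+1 | (j <= i - k)%N) coef3 j k).
  apply: eq_bigl => j; rewrite -ltnS -(ltnS j) -!subSn ?leq_ord //.
  by rewrite -subn_gt0 -(subn_gt0 j) -!subnDA addnC.
rewrite (big_ord_narrow_leq (leq_subr _ _)) coef_skew_mul big_distrl /=.
by apply: eq_bigr => j _; rewrite /coef3 -!subnDA addnC mulrA.
Qed.

Fact skew_mul1p : left_id (1%:P : R) skew_mul.
Proof.
move=> p; apply/polyP => i; rewrite coef_skew_mul big_ord_recl subn0.
by rewrite big1 => [|j _]; rewrite coefC ?mul0r //= mul1r addr0.
Qed.

Fact skew_mulp1 : right_id (1%:P : R) skew_mul.
Proof.
move=> p; apply/polyP => i; rewrite coef_skew_mul_rev big_ord_recl subn0.
by rewrite big1 => [|j _]; rewrite coefC ?rmorph0 ?mulr0 //= rmorph1 mulr1 addr0.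
Qed.

Fact skew_mulDl : left_distributive skew_mul +%R.
Proof.
move=> p q r; apply/polyP=> i; rewrite coefD !coef_skew_mul -big_split.
by apply: eq_bigr => j _; rewrite coefD mulrDl.
Qed.

Fact skew_mulDr : right_distributive skew_mul +%R.
Proof.
move=> p q r; apply/polyP=> i; rewrite coefD !coef_skew_mul -big_split.
by apply: eq_bigr => j _; rewrite coefD rmorphD mulrDr.
Qed.

Fact skew_poly1_neq0 : (1%:P : R) != 0.
Proof. by rewrite polyC_eq0 oner_neq0. Qed.

HB.instance Definition _ := GRing.Zmodule_isNzRing.Build R
  skew_mulA skew_mul1p skew_mulp1 skew_mulDl skew_mulDr skew_poly1_neq0.

Definition skewC (a : A) : R := a%:P.
Definition skewX : R := 'X.

Lemma coef_skewM p q i :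
  (p * q : R)`_i = \sum_(j < i.+1) p`_j * twist j q`_(i - j).
Proof. exact: coef_skew_mul. Qed.

Lemma coef_skewCM a p i : (skewC a * p)`_i = a * p`_i.
Proof.
rewrite coef_skewM big_ord_recl subn0 coefC big1 ?addr0 // => j _.
by rewrite coefC mul0r.
Qed.

Lemma skewCM a b : skewC (a * b) = skewC a * skewC b.
Proof. by apply/polyP => i; rewrite coef_skewCM !coefC; case: eqP; rewrite ?mulr0. Qed.

Lemma coef_skewMX p i : (p * skewX)`_i = if i is j.+1 then p`_j else 0.
Proof.
rewrite coef_skewM; case: i => [|i].
  by rewrite big_ord_recl big_ord0 coefX rmorph0 ?mulr0 addr0 ?mulr0.
rewrite big_ord_recr /= subnn coefX rmorph0 mulr0 addr0.
rewrite big_ord_recr /= subSn // subnn coefX rmorph1 mulr1.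
rewrite big1 ?add0r // => j _.
by rewrite coefX subSn 1?ltnW // eqSS subn_eq0 leqNgt ltn_ord rmorph0 mulr0.
Qed.

Lemma skewXC a : skewX * skewC a = skewC (s a) * skewX.
Proof.
apply/polyP => i; rewrite coef_skewCM coefX coef_skewM.
case: i => [|i].
  by rewrite big_ord_recl big_ord0 coefX mul0r addr0 mulr0.
rewrite big_ord_recl coefX mul0r add0r big_ord_recl big1 => [|j _].
  by rewrite coefX /= mul1r addr0 coefC subn_eq0; case: i => [|i];
     rewrite ?mulr1 ?mulr0 ?rmorph0.
by rewrite coefX mul0r.
Qed.

Lemma coef_skewXn m i : (skewX ^+ m)`_i = (i == m)%:R.
Proof.
elim: m i => [|m IHm] i; first by rewrite expr0 coefC; case: eqP.
by rewrite exprSr coef_skewMX; case: i.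
Qed.

Lemma skewXnC m a : skewX ^+ m * skewC a = skewC (twist m a) * skewX ^+ m.
Proof.
elim: m => [|m IHm]; first by rewrite expr0 mulr1 mul1r.
by rewrite exprS -mulrA IHm mulrA skewXC -mulrA.
Qed.

Lemma skew_polyE p : p = \sum_(i < size (p : {poly A})) skewC p`_i * skewX ^+ i.
Proof.
rewrite -[LHS](coefK p) poly_def; apply: eq_bigr => i _.
by apply/polyP => j; rewrite coef_skewCM coef_skewXn coefZ coefXn.
Qed.

End SkewPoly.

Arguments skewC {A} s a.
Arguments skewX {A} s.

(* The library only puts a ring structure on {quot I} for commutative rings.  *)
(* Note that `idealr' provides closure under multiplication on the left.      *)
Section TwoSidedQuotient.
Variables (R : nzRingType) (I : idealr R).

Definition right_absorbing := forall u a : R, u \in I -> u * a \in I.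

Definition tsquot (_ : right_absorbing) : Type := {ideal_quot I}.

Variable hI : right_absorbing.
Local Notation Q := (tsquot hI).

HB.instance Definition _ := GRing.Zmodule.on Q.
HB.instance Definition _ := ZmodQuotient.on Q.

Definition tsq_one : Q := lift_cst Q 1.
Definition tsq_mul := lift_op2 Q *%R.

Canonical pi_tsq_one_morph := PiConst tsq_one.

Fact pi_tsq_mul : {morph \pi : x y / x * y >-> tsq_mul x y}.
Proof.
move=> x y; unlock tsq_mul; apply/eqP; rewrite piE Quotient.equivE.
rewrite -[_ * _](addrNK (x * repr (\pi_Q y))) -mulrBr.
rewrite -addrA -mulrBl rpredD //.
  by rewrite idealMr // Quotient.idealrDE opprK reprK.
by rewrite hI // Quotient.idealrDE opprK reprK.
Qed.
Canonical pi_tsq_mul_morph := PiMorph2 pi_tsq_mul.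

Fact tsq_mulA : associative tsq_mul.
Proof. by move=> x y z; rewrite -[x]reprK -[y]reprK -[z]reprK !piE mulrA. Qed.

Fact tsq_mul1q : left_id tsq_one tsq_mul.
Proof. by move=> x; rewrite -[x]reprK !piE mul1r. Qed.

Fact tsq_mulq1 : right_id tsq_one tsq_mul.
Proof. by move=> x; rewrite -[x]reprK !piE mulr1. Qed.

Fact tsq_mulDl : left_distributive tsq_mul +%R.
Proof.
move=> x y z; rewrite -[x]reprK -[y]reprK -[z]reprK.
by rewrite -[_ + _ in LHS]pi_addr -!pi_tsq_mul -[_ + _ in RHS]pi_addr mulrDl.
Qed.

Fact tsq_mulDr : right_distributive tsq_mul +%R.
Proof.
move=> x y z; rewrite -[x]reprK -[y]reprK -[z]reprK.
by rewrite -[_ + _ in LHS]pi_addr -!pi_tsq_mul -[_ + _ in RHS]pi_addr mulrDr.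
Qed.

Fact tsq_one_neq0 : tsq_one != 0.
Proof. by rewrite piE Quotient.equivE subr0 idealr1. Qed.

HB.instance Definition _ := GRing.Zmodule_isNzRing.Build Q
  tsq_mulA tsq_mul1q tsq_mulq1 tsq_mulDl tsq_mulDr tsq_one_neq0.
HB.instance Definition _ := @isNzRingQuotient.Build
  R (Quotient.equiv I) 0 -%R +%R 1%R *%R Q (lock _) pi_tsq_mul.

Definition tsq_invertible (x : Q) := exists y, y * x = 1 /\ x * y = 1.
Definition tsq_unit : pred Q := fun x => `[< tsq_invertible x >].
Definition tsq_inv (x : Q) : Q :=
  if pselect (tsq_invertible x) is left e then sval (cid e) else x.

Fact tsq_mulVr : {in tsq_unit, left_inverse 1 tsq_inv *%R}.
Proof.
move=> x /asboolP ux; rewrite /tsq_inv; case: pselect => // e.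
by case: (svalP (cid e)).
Qed.

Fact tsq_mulrV : {in tsq_unit, right_inverse 1 tsq_inv *%R}.
Proof.
move=> x /asboolP ux; rewrite /tsq_inv; case: pselect => // e.
by case: (svalP (cid e)).
Qed.

Fact tsq_unitP (x y : Q) : y * x = 1 /\ x * y = 1 -> tsq_unit x.
Proof. by move=> xy; apply/asboolP; exists y. Qed.

Fact tsq_inv_out : {in [predC tsq_unit], tsq_inv =1 id}.
Proof.
by move=> x /asboolP ux; rewrite /tsq_inv; case: pselect.
Qed.

HB.instance Definition _ := GRing.NzRing_hasMulInverse.Build Q
  tsq_mulVr tsq_mulrV tsq_unitP tsq_inv_out.

End TwoSidedQuotient.

Section SkewQuotient.
Variables (K : finFieldType) (L : splittingFieldType K) (sigma : gal_of {:L}).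

Local Notation n := (\dim {:L}).
Definition gal_rmorph : {rmorphism L -> L} := sigma.

Local Notation R := (skew_poly gal_rmorph).

Lemma twist_gal m a : twist gal_rmorph m a = (sigma ^+ m)%g a.
Proof.
elim: m => [|m IHm]; first by rewrite expg0 gal_id.
by rewrite expgSr galM ?memvf // -IHm.
Qed.

Lemma twist_dim a : twist gal_rmorph n a = a.
Proof.
have sG : sigma \in 'Gal({:L} / 1%AS)%g.
  by rewrite gal_kHom ?sub1v //; apply/kAHomP => x /vlineP [c ->];
     rewrite linearZ /= rmorph1.
have := galois_dim (finField_galois (sub1v {:L})).
rewrite dimv1 divn1 twist_gal => ->.
by rewrite expg_cardG ?gal_id.
Qed.

(* F(X^n) for F in K[Y], with n = [L : K].                                    *)
Definition evalXn (F : {poly K}) : R :=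
  \sum_(i < size F) skewC gal_rmorph (F`_i)%:A * (skewX gal_rmorph ^+ n) ^+ i.

Lemma evalXn_central (F : {poly K}) (p : R) : evalXn F * p = p * evalXn F.
Proof.
rewrite /evalXn mulr_suml mulr_sumr; apply: eq_bigr => i _.
rewrite [p]skew_polyE mulr_suml mulr_sumr; apply: eq_bigr => j _.
rewrite -exprM -!mulrA [in LHS](mulrA (_ ^+ _)) skewXnC.
have -> b : twist gal_rmorph (n * i) b = b.
  elim: (nat_of_ord i) => [|m IHm]; first by rewrite muln0.
  by rewrite mulnS twistD IHm twist_dim.
rewrite [in RHS](mulrA (_ ^+ j)) skewXnC.
have -> : twist gal_rmorph j (F`_i)%:A = (F`_i)%:A.
  by rewrite twist_gal linearZ /= rmorph1.
by rewrite !mulrA -!skewCM (mulrC p`_j) -!mulrA -!exprD addnC.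
Qed.

Variables (F : {poly K}) (hF : monic_irreducible_poly F).

(* The two-sided ideal R F(X^n).                                              *)
Definition skew_ideal (_ : monic_irreducible_poly F) : {pred R} :=
  fun p => `[< exists g : R, p = g * evalXn F >].

Lemma coef_evalXn j :
  (evalXn F)`_j = \sum_(i < size F) (F`_i)%:A *+ (j == n * i)%N.
Proof.
rewrite /evalXn coef_sum; apply: eq_bigr => i _.
by rewrite -exprM coef_skewCM coef_skewXn mulr_natr.
Qed.

Fact skew_ideal_closed : idealr_closed (skew_ideal hF).
Proof.
split=> [||a u v /asboolP[g ->] /asboolP[h ->]].
- by apply/asboolP; exists 0; rewrite mul0r.
- apply/asboolP => -[g g1].
  have [[ltF _] monF] := hF.
  have n0 : (0 < n)%N by rewrite adim_gt0.
  have sF : (0 < size F)%N by rewrite ltnW.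
  pose m := (n * (size F).-1)%N; pose d := (size (g : {poly L})).-1.
  have m0 : (0 < m)%N by rewrite muln_gt0 n0 -ltnS prednK.
  have cm : (evalXn F)`_m = 1.
    rewrite coef_evalXn -(prednK sF) big_ord_recr /= eqxx.
    rewrite -[F`_ _]/(lead_coef F) (monicP monF) scale1r big1 ?add0r // => i _.
    by rewrite eqn_pmul2l // gtn_eqF.
  have cj j : (m < j)%N -> (evalXn F)`_j = 0.
    move=> mj; rewrite coef_evalXn big1 // => i _.
    rewrite gtn_eqF //; apply: leq_ltn_trans mj.
    by rewrite leq_pmul2l // -ltnS prednK.
  have := congr1 (fun p : R => p`_(d + m)) g1.
  rewrite coefC gtn_eqF ?addn_gt0 ?m0 ?orbT //.
  rewrite coef_skewM (bigD1 (inord d)) //= inordK ?ltnS ?leq_addr //.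
  rewrite addKn cm rmorph1 mulr1 big1 ?addr0 => [/esym/eqP|j jd].
    rewrite -[_`_d]/(lead_coef (g : {poly L})) lead_coef_eq0 => /eqP g0.
    by have := oner_neq0 R; rewrite g1 [g]g0 mul0r eqxx.
  have {}jd : (j : nat) != d.
    by apply: contraNneq jd => jd; apply/eqP/ord_inj; rewrite inordK ?ltnS ?leq_addr.
  have [ltjd|ledj] := ltnP j d.
    by rewrite cj ?rmorph0 ?mulr0 // ltn_subRL ltn_add2r.
  rewrite nth_default ?mul0r //; apply: leq_trans (leqSpred _) _.
  by rewrite ltn_neqAle eq_sym jd.
- by apply/asboolP; exists (a * g + h); rewrite mulrDl mulrA.
Qed.

HB.instance Definition _ := isIdealr.Build R (skew_ideal hF) skew_ideal_closed.

Fact skew_idealMr : right_absorbing (skew_ideal hF).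
Proof.
move=> u a /asboolP[g ->]; apply/asboolP; exists (g * a).
by rewrite -[LHS]mulrA evalXn_central mulrA.
Qed.

(* R_F = R / R F(X^n)                                                         *)
Definition skew_quot : Type := tsquot skew_idealMr.

HB.instance Definition _ := GRing.UnitRing.on skew_quot.

Definition skew_class : R -> skew_quot := \pi_(tsquot skew_idealMr).

HB.instance Definition _ := GRing.RMorphism.on skew_class.

Lemma skew_class_eq (p q : R) :
  skew_class p = skew_class q <-> exists g : R, p - q = g * evalXn F.
Proof.
have E : (p - q \in skew_ideal hF) = (skew_class p == skew_class q).
  exact: Quotient.idealrBE.
by split=> [/eqP|pq]; [rewrite -E => /asboolP|apply/eqP; rewrite -E; apply/asboolP].
Qed.

End SkewQuotient.

Section Code.
Variables (K : finFieldType) (L : splittingFieldType K) (sigma : gal_of {:L}).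
Variables (F : {poly K}) (hF : monic_irreducible_poly F).

Local Notation n := (\dim {:L}).
Local Notation RF := (skew_quot sigma hF).

Definition quotC (a : L) : RF := skew_class hF (skewC (gal_rmorph sigma) a).
Definition quotX : RF := skew_class hF (skewX (gal_rmorph sigma)).

Lemma quotXC a : quotX * quotC a = quotC (sigma a) * quotX.
Proof. by rewrite /quotX /quotC -!rmorphM skewXC. Qed.

(* S_k(F); here (size F).-1 is the degree s of F.                             *)
Definition skew_code (k : nat) : set RF :=
  [set skew_class hF (\sum_(i < (size F).-1 * k)
         skewC (gal_rmorph sigma) (alpha i) * skewX (gal_rmorph sigma) ^+ i)
     | alpha in [set: 'I_((size F).-1 * k) -> L]].

(* E_F = Z(R_F)                                                               *)
Definition quot_center : set RF := [set c | forall x : RF, c * x = x * c].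

(* Aut_{E_F}(S), expressed inside R_F (isomorphic to M_n(E_F)).               *)
Definition linear_aut (S : set RF) : set (RF * RF) :=
  [set gh | [/\ gh.1 \is a GRing.unit, gh.2 \is a GRing.unit
              & [set gh.1 * x * gh.2 | x in S] = S]].

(* G_F; the units of R_F lying in E_F are exactly the units of E_F.           *)
Definition monomial_group : set RF :=
  [set g | exists (c : RF) (gamma : L) (t : 'I_n),
     [/\ quot_center c, c \is a GRing.unit, gamma != 0
       & g = c * quotC gamma * quotX ^+ t]].

(* A_F                                                                        *)
Definition monomial_aut : set (RF * RF) :=
  [set gh | exists (g : RF) (lambda : L),
     [/\ monomial_group g, lambda != 0 & gh = (g, g^-1 * quotC lambda)]].

End Code.

Arguments quot_center {K L} sigma {F} hF _.
Arguments skew_code {K L} sigma {F} hF k _.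
Arguments monomial_group {K L} sigma {F} hF _.
Arguments monomial_aut {K L} sigma {F} hF _.

(* Main.v *)
(* The left and right idealisers of the code are both L, by a degree          *)
(* argument in reduced representatives, so a stabilising pair (g, h)          *)
(* normalises L, and comparing coefficients gives g = X^t u and h X^t = X^m v *)
(* with u, v in the centraliser L[Y]/(F) of L, where Y = X^n.  Splitting the  *)
(* code by exponents modulo n turns the stability condition into inclusions   *)
(* W_r L[Y]_{<d_r} <= L[Y]_{<d_{r+m}}, where W_r is a unit and d_r counts the *)
(* exponents congruent to r.  These force all the d_r to be equal when m > 0, *)
(* and W_r to be in L whenever 0 < d_r = d_{r+m} < s.  Two consecutive r give *)
(* X v = z v X Y^i with z in L and i in {0, 1}.  If i = 0, then z has norm 1  *)
(* and Hilbert 90 makes v a central unit times a scalar.  If m > 0, then      *)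
(* i = 1 occurs, which is only possible for n = 2 and Y^2 in F_q, i.e., in    *)
(* the excluded case F = Y^2 - nu.                                            *)

From HB Require Import structures.
Require Import Defs.
From mathcomp Require Import all_boot all_fingroup all_algebra all_solvable all_field.
From mathcomp Require Import zify.
From mathcomp Require Import boolp classical_sets.

Import GRing.Theory.
Local Open Scope ring_scope.

(** Each class has exactly one representative of degree below [n * s] ([pi_reduced], [pi_inj]), and
    the code is the set of classes whose representative has degree below [s * k]. Since 0 < s k < n
    s, only elements of L can stabilise it by one-sided multiplication ([left_idealiser],
    [right_idealiser]). For a stabilising pair (g, h), the fields g L g^-1 and h^-1 L h act in this
    way, so g and h normalise L; they are therefore powers of X times elements of the centraliser
    L[Y], Y = X^n ([quot_normal], [quot_centE]). After conjugation by a power of X the pair becomes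
    a map x -> u x X^m v with u, v in L[Y].

    This map sends exponents congruent to r modulo n to exponents congruent to r + m, acting there
    by one polynomial W_r in Y. Multiplication by W_r can carry d consecutive powers of Y into d' <
    s of them only if d <= d', and if d = d' > 0 then W_r is constant ([evY_low_stable],
    [code_shift]). Comparing two adjacent constants gives a relation between X v and v X
    ([semilinear_step]), whose n-fold iterate is a norm equation because X^n is central
    ([semilinear_norm]).

    If m > 0, adjacent residues around m give X v = z v Y X. For n > 2 another adjacent pair gives X
    v = z' v X, hence z Y = z', which is absurd as deg F > 1; for n = 2 the norm equation puts Y^2
    in K, the excluded case ([shift_eq0]). If m = 0, the norm of z is 1 and Hilbert 90 splits v into
    a central unit and a scalar ([core_form]). Conversely, conjugation by monomials and
    multiplication by scalars preserve degree bounds ([monomial_linear_aut]). *)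

Section SkewMonomials.
Set Implicit Arguments.
Unset Strict Implicit.
Unset Printing Implicit Defensive.
Variables (A : nzRingType) (f : {rmorphism A -> A}).
Local Notation R := (skew_poly f).
Local Notation skX := (skewX f).
Implicit Types p : R.

(** * Products with monomials and constants in the skew polynomial ring *)

Lemma coef_skewMXn p m j :
  (p * skX ^+ m)`_j = if (j < m)%N then 0 else p`_(j - m).
Proof.
elim: m j => [|m IHm] j; first by rewrite expr0 mulr1 subn0.
rewrite exprSr mulrA coef_skewMX; by case: j.
Qed.

Lemma coef_skewXnM p m j :
  (skX ^+ m * p)`_j = if (j < m)%N then 0 else twist f m p`_(j - m).
Proof.
rewrite coef_skewM; case: ltnP => [ltjm|lemj].
  rewrite big1 // => i _; rewrite coef_skewXn ltn_eqF ?mul0r //.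
  exact: leq_trans (ltn_ord i) ltjm.
rewrite -ltnS in lemj; rewrite (bigD1 (Ordinal lemj)) //= coef_skewXn eqxx mul1r.
rewrite big1 ?addr0 // => i; rewrite -val_eqE /= coef_skewXn => /negPf->.
by rewrite mul0r.
Qed.

Lemma coef_skewMC p a i : (p * skewC f a)`_i = p`_i * twist f i a.
Proof.
rewrite coef_skewM big_ord_recr /= subnn coefC eqxx big1 ?add0r // => j _.
by rewrite coefC subn_eq0 leqNgt ltn_ord rmorph0 mulr0.
Qed.

Lemma size_skewMXn p m :
  (size (p * skX ^+ m : {poly A})%R <= size (p : {poly A}) + m)%N.
Proof.
apply/leq_sizeP => j lej; rewrite coef_skewMXn; case: ltnP => // lemj.
by rewrite nth_default // leq_subRL // addnC.
Qed.

Lemma size_skewXnM p m :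
  (size (skX ^+ m * p : {poly A})%R <= size (p : {poly A}) + m)%N.
Proof.
apply/leq_sizeP => j lej; rewrite coef_skewXnM; case: ltnP => // lemj.
by rewrite nth_default ?rmorph0 // leq_subRL // addnC.
Qed.

Lemma size_skewMC p a :
  (size (p * skewC f a : {poly A})%R <= size (p : {poly A}))%N.
Proof. by apply/leq_sizeP => j lej; rewrite coef_skewMC nth_default ?mul0r. Qed.

Lemma size_skewCM p a :
  (size (skewC f a * p : {poly A})%R <= size (p : {poly A}))%N.
Proof. by apply/leq_sizeP => j lej; rewrite coef_skewCM nth_default ?mulr0. Qed.

End SkewMonomials.

Section SkewQuotientTheory.
Set Implicit Arguments.
Unset Strict Implicit.
Unset Printing Implicit Defensive.
Variables (K : finFieldType) (L : splittingFieldType K) (sigma : gal_of {:L}).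
Variables (F : {poly K}) (hF : monic_irreducible_poly F).

Local Notation n := (\dim {:L}).
Local Notation s := (size F).-1.
Local Notation R := (skew_poly (gal_rmorph sigma)).
Local Notation RF := (skew_quot sigma hF).
Local Notation pi := (skew_class hF : R -> RF).
Local Notation C := (quotC sigma hF).
Local Notation X := (quotX sigma hF).
Local Notation tw := (twist (gal_rmorph sigma)).
Local Notation E := (evalXn sigma F).

(** * Reduced representatives modulo F(X^n) *)

Lemma n_gt0 : (0 < n)%N. Proof. exact: adim_gt0. Qed.

Lemma size_gt0 : (0 < size F)%N.
Proof. by case: hF => -[/ltnW]. Qed.

Lemma coef_evalXn_deg : E`_(n * s) = 1.
Proof.
rewrite coef_evalXn -(prednK size_gt0) big_ord_recr /= eqxx.
have /monicP := hF.2; rewrite /lead_coef => ->; rewrite scale1r big1 ?add0r // => i _.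
by rewrite eqn_pmul2l ?n_gt0 // gtn_eqF.
Qed.

Lemma coef_evalXn_gt j : (n * s < j)%N -> E`_j = 0.
Proof.
move=> ltj; rewrite coef_evalXn big1 // => i _; rewrite gtn_eqF //.
by apply: leq_ltn_trans ltj; rewrite leq_pmul2l ?n_gt0 // -ltnS prednK ?size_gt0.
Qed.

Lemma coef_mul_evalXn_top (g : R) d : (size (g : {poly L}) <= d.+1)%N ->
  (g * E)`_(d + n * s) = g`_d.
Proof.
move=> le_g; rewrite coef_skewM.
have ltd : (d < (d + n * s).+1)%N by rewrite ltnS leq_addr.
rewrite (bigD1 (Ordinal ltd)) //= addKn coef_evalXn_deg rmorph1 mulr1.
rewrite big1 ?addr0 // => j; rewrite -val_eqE /= => ne_jd.
have [ltjd|ledj] := ltnP j d.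
  by rewrite coef_evalXn_gt ?rmorph0 ?mulr0 // ltn_subRL ltn_add2r.
rewrite nth_default ?mul0r //; apply: leq_trans le_g _.
by rewrite ltn_neqAle eq_sym ne_jd.
Qed.

Lemma size_mul_evalXn_le (g : R) :
  (size ((g * E)%R : {poly L}) <= n * s)%N -> g = 0.
Proof.
move=> le_sz; apply/eqP; apply: contraT => g0.
have sg : (0 < size (g : {poly L}))%N by rewrite size_poly_gt0.
have := @coef_mul_evalXn_top g (size (g : {poly L})).-1.
rewrite prednK // => /(_ (leqnn _)) /esym/eqP.
rewrite [X in _ == X]nth_default ?(leq_trans le_sz) ?leq_addl //.
by rewrite -[_ == _]/(lead_coef (g : {poly L}) == 0) lead_coef_eq0 (negPf g0).
Qed.

(** F(X^n) is monic of degree [n * s], so no nonzero left multiple of it has smaller degree. *)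
Lemma pi_inj (p q : R) : (size (p : {poly L}) <= n * s)%N ->
  (size (q : {poly L}) <= n * s)%N -> pi p = pi q -> p = q.
Proof.
move=> lep leq /skew_class_eq[g pqE]; apply/eqP; rewrite -subr_eq0 pqE.
rewrite (@size_mul_evalXn_le g) ?mul0r // -pqE.
by apply: leq_trans (size_polyD _ _) _; rewrite size_polyN geq_max lep leq.
Qed.

(** Right division by F(X^n): subtracting c X^d F(X^n) cancels the top coefficient c, because the
    leading coefficient 1 is not affected by the twist. *)
Lemma pi_reduced (x : RF) :
  exists2 p : R, (size (p : {poly L}) <= n * s)%N & x = pi p.
Proof.
have [p0 ->] : exists p, x = pi p.
  exists (generic_quotient.repr x).
  by rewrite /skew_class generic_quotient.reprK.
have [m] := ubnP (size (p0 : {poly L})); elim: m p0 => // m IHm p0.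
rewrite ltnS => szp; have [le_p|lt_p] := leqP (size (p0 : {poly L})) (n * s).
  by exists p0.
pose d := ((size (p0 : {poly L})).-1 - n * s)%N.
have dE : (d + n * s)%N = (size (p0 : {poly L})).-1.
  by rewrite subnK // -ltnS prednK // (leq_ltn_trans _ lt_p).
pose g : R := skewC (gal_rmorph sigma) p0`_(d + n * s) * skewX (gal_rmorph sigma) ^+ d.
have gE i : g`_i = if i == d then p0`_(d + n * s) else 0.
  by rewrite coef_skewCM coef_skewXn; case: eqP; rewrite ?mulr1 ?mulr0.
have lt_p0 : (0 < size (p0 : {poly L}))%N by apply: leq_ltn_trans lt_p.
have [|p lep pE] := IHm (p0 - g * E); last first.
  exists p => //; rewrite -pE; apply/skew_class_eq; exists g.
  by rewrite opprB addrCA subrr addr0.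
apply: leq_trans szp; rewrite -[X in (_ < X)%N](prednK lt_p0) ltnS -dE.
apply/leq_sizeP => j lej; rewrite coefB.
have [->|ne_j] := eqVneq j (d + n * s)%N.
  rewrite coef_mul_evalXn_top ?gE ?eqxx ?subrr //.
  by apply/leq_sizeP => i lei; rewrite gE gtn_eqF.
rewrite [X in X - _]nth_default; last first.
  by rewrite -(prednK lt_p0) -dE ltn_neqAle eq_sym ne_j.
rewrite sub0r coef_skewM big1 ?oppr0 // => i _; rewrite gE.
case: eqP => [->|_]; last by rewrite mul0r.
rewrite coef_evalXn_gt ?rmorph0 ?mulr0 // ltn_subRL.
by rewrite ltn_neqAle eq_sym ne_j.
Qed.

(** * The embedding of L and the central element Y = X^n *)

Fact quotC_is_zmod_morphism : zmod_morphism C.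
Proof. by move=> a b; rewrite /quotC -rmorphB /skewC -polyCB. Qed.

Fact quotC_is_monoid_morphism : monoid_morphism C.
Proof.
split=> [|a b]; first by rewrite /quotC -[skewC _ 1]/(1 : R) rmorph1.
by rewrite /quotC skewCM rmorphM.
Qed.

HB.instance Definition _ :=
  GRing.isZmodMorphism.Build L RF C quotC_is_zmod_morphism.
HB.instance Definition _ :=
  GRing.isMonoidMorphism.Build L RF C quotC_is_monoid_morphism.

Lemma deg_gt0 : (0 < s)%N.
Proof. by case: hF => -[]; case: (size F) => [|[]]. Qed.

Lemma ns_gt0 : (0 < n * s)%N.
Proof. by rewrite muln_gt0 n_gt0 deg_gt0. Qed.

Lemma quotC_inj : injective C.
Proof.
move=> a b eq_ab; apply: polyC_inj.
by apply: (@pi_inj (skewC _ a) (skewC _ b)) eq_ab;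
   apply: leq_trans (size_polyC_leq1 _) ns_gt0.
Qed.

Lemma quotC_unit a : a != 0 -> C a \is a GRing.unit.
Proof. by move=> a0; rewrite rmorph_unit ?unitfE. Qed.

Lemma quotXnC m a : X ^+ m * C a = C (tw m a) * X ^+ m.
Proof. by rewrite /quotX /quotC -!rmorphXn -!rmorphM skewXnC. Qed.

Lemma tw_dimM i a : tw (n * i) a = a.
Proof.
elim: i => [|i IHi]; first by rewrite muln0.
by rewrite mulnS twistD IHi twist_dim.
Qed.

Lemma tw_mod i a : tw (i %% n) a = tw i a.
Proof. by rewrite [in RHS](divn_eq i n) addnC mulnC twistD tw_dimM. Qed.

Local Notation Y := (X ^+ n).

Lemma quotXn_comm a : GRing.comm Y (C a).
Proof. by rewrite /GRing.comm quotXnC twist_dim. Qed.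

Lemma quotX_gen (P : RF -> Prop) :
  (forall x y, P x -> P y -> P (x + y)) -> (forall a i, P (C a * X ^+ i)) ->
  forall x, P x.
Proof.
move=> PD PM x; have [p _ ->] := pi_reduced x; rewrite [p]skew_polyE rmorph_sum.
apply: (big_ind P) => [|//|i _].
  by have := PM 0 0%N; rewrite rmorph0 mul0r.
by rewrite rmorphM rmorphXn; apply: PM.
Qed.

Lemma quot_centerP (c : RF) :
  (forall a, c * C a = C a * c) -> c * X = X * c -> quot_center sigma hF c.
Proof.
move=> cC cX; apply: quotX_gen => [x y cx cy|a i]; first by rewrite mulrDl mulrDr cx cy.
by rewrite mulrA cC -!mulrA; congr (_ * _); apply: commrX.
Qed.

Lemma quotXn_center : quot_center sigma hF Y.
Proof.
by apply: quot_centerP => [a|]; [apply: quotXn_comm | rewrite -exprS exprSr].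
Qed.

(** * Evaluation of polynomials over L at Y *)

Definition evY : {poly L} -> RF := horner_morph (fun a => quotXn_comm a).
HB.instance Definition _ := GRing.RMorphism.on evY.

Lemma evYX : evY 'X = Y. Proof. exact: horner_morphX. Qed.
Lemma evYC a : evY a%:P = C a. Proof. exact: horner_morphC. Qed.

Lemma evYE m (p : {poly L}) : (size p <= m)%N ->
  evY p = \sum_(i < m) C p`_i * X ^+ (n * i).
Proof.
move=> lepm; have -> : p = \poly_(i < m) p`_i.
  apply/polyP => i; rewrite coef_poly; case: ltnP => //.
  by move=> /(leq_trans lepm)/(nth_default 0).
rewrite {1}poly_def rmorph_sum; apply: eq_bigr => i _.
by rewrite -mul_polyC rmorphM rmorphXn /= evYX evYC -exprM coef_poly ltn_ord.
Qed.

Local Notation FL := (map_poly (in_alg L) F).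

Lemma size_FL : size FL = size F.
Proof. exact: size_map_poly. Qed.

Lemma pi_evalXn : pi E = 0.
Proof.
rewrite -(rmorph0 pi); apply/skew_class_eq.
by exists 1; rewrite subr0 mul1r.
Qed.

Lemma evY_F : evY FL = 0.
Proof.
rewrite -pi_evalXn (@evYE (size F)) ?size_FL // rmorph_sum; apply: eq_bigr => i _.
by rewrite rmorphM -exprM rmorphXn coef_map.
Qed.

Hypothesis s_gt1 : (1 < s)%N.

Lemma F0_neq0 : F`_0 != 0.
Proof.
have [[_ irrF] _] := hF; rewrite -horner_coef0; apply/negP.
rewrite -/(root F 0) -dvdp_XsubCl subr0 => /(irrF 'X).
rewrite size_polyX => /(_ isT) /eqp_size.
by rewrite size_polyX => szF; move: s_gt1; rewrite -szF.
Qed.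

(** Irreducibility in degree at least 2 gives F(0) != 0, and F(Y) = 0 then reads Y q(Y) = -F(0), so
    Y, hence X, is invertible. *)
Lemma quotX_unit : X \is a GRing.unit.
Proof.
have [q FLE] : exists q, FL - (F`_0)%:A%:P = q * ('X - 0%:P).
  apply/factor_theorem; rewrite /root hornerD hornerN hornerC.
  by rewrite horner_coef0 coef_map subrr.
have YE : Y * evY q = C (- (F`_0)%:A).
  have := congr1 evY FLE; rewrite subr0 [q * _]mulrC rmorphM rmorphB /= evYX evYC evY_F.
  by rewrite sub0r rmorphN.
have C0 : C (- (F`_0)%:A) \is a GRing.unit.
  by rewrite quotC_unit // oppr_eq0 scaler_eq0 oner_eq0 orbF F0_neq0.
have Yq : GRing.comm Y (evY q) by rewrite -evYX /GRing.comm -!rmorphM mulrC.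
by move: C0; rewrite -YE unitrM_comm // => /andP[]; rewrite unitrX_pos ?n_gt0.
Qed.

Lemma pi_sum_spread m r (p : {poly L}) : (r < n)%N ->
  (\sum_(i < m) skewC (gal_rmorph sigma) p`_i *
                skewX (gal_rmorph sigma) ^+ (n * i + r) : R)
  = \poly_(j < n * m) (if (j %% n == r)%N then p`_(j %/ n) else 0) :> {poly L}.
Proof.
move=> ltr; apply/polyP => j; rewrite coef_sum coef_poly mulnC -ltn_divLR ?n_gt0 //.
under eq_bigr => i _ do rewrite coef_skewCM coef_skewXn.
have jE (i : 'I_m) : (j == n * i + r)%N = (j %% n == r)%N && (j %/ n == i)%N.
  apply/eqP/andP => [->|[/eqP <- /eqP <-]]; last by rewrite mulnC -divn_eq.
  by rewrite mulnC modnMDl divnMDl ?n_gt0 // modn_small ?divn_small ?addn0 ?eqxx.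
under eq_bigr => i _ do rewrite jE.
case: eqP => _; last by rewrite if_same big1 // => i _; rewrite mulr0.
case: ltnP => [ltj|lej].
  rewrite (bigD1 (Ordinal ltj)) //= eqxx mulr1 big1 ?addr0 // => i.
  by rewrite -val_eqE /= eq_sym => /negPf->; rewrite mulr0.
by rewrite big1 // => i _; rewrite gtn_eqF ?mulr0 // (leq_trans (ltn_ord i)).
Qed.

(** The bound on [p] makes the spread-out polynomial reduced, so degree conditions on p(Y) X^r can
    be read off coefficientwise. *)
Lemma evY_spread r (p : {poly L}) : (r < n)%N -> (size p <= s)%N ->
  evY p * X ^+ r =
    pi (\poly_(j < n * s) (if (j %% n == r)%N then p`_(j %/ n) else 0)).
Proof.
move=> ltr lep; rewrite -pi_sum_spread // rmorph_sum (evYE lep) mulr_suml.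
by apply: eq_bigr => i _; rewrite rmorphM rmorphXn -mulrA -exprD.
Qed.

(** * The code as a degree bound, and its idealisers *)

Definition low_degree (m : nat) (x : RF) :=
  exists2 p : R, (size (p : {poly L}) <= m)%N & x = pi p.

Lemma low_degree_pi m (p : R) : (m <= n * s)%N ->
  (size (p : {poly L}) <= n * s)%N -> low_degree m (pi p) ->
  (size (p : {poly L}) <= m)%N.
Proof. by move=> lem lep [q leq] /pi_inj -> //; apply: leq_trans lem. Qed.

Lemma low_degreeXn m i : (i < m)%N -> low_degree m (X ^+ i).
Proof.
move=> lti; exists (skewX _ ^+ i); last by rewrite rmorphXn.
by apply/leq_sizeP => j /(leq_trans lti) ltij; rewrite coef_skewXn gtn_eqF.
Qed.

Lemma low_degreeMC m x a : low_degree m x -> low_degree m (x * C a).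
Proof.
case=> p lep ->; exists (p * skewC _ a); last by rewrite rmorphM.
exact: leq_trans (size_skewMC _ _) lep.
Qed.

Lemma low_degreeCM m x a : low_degree m x -> low_degree m (C a * x).
Proof.
case=> p lep ->; exists (skewC _ a * p); last by rewrite rmorphM.
exact: leq_trans (size_skewCM _ _) lep.
Qed.

Lemma skew_codeP k x : skew_code sigma hF k x <-> low_degree (s * k) x.
Proof.
split=> [[alpha _ <-]|[p lep ->]].
  exists (\sum_(i < s * k) skewC (gal_rmorph sigma) (alpha i) *
                            skewX (gal_rmorph sigma) ^+ i) => //.
  apply/leq_sizeP => j lej; rewrite coef_sum big1 // => i _.
  by rewrite coef_skewCM coef_skewXn gtn_eqF ?mulr0 // (leq_trans (ltn_ord i)).
exists (fun i => p`_i) => //; congr pi; apply/polyP => j; rewrite coef_sum.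
under eq_bigr => i _ do rewrite coef_skewCM coef_skewXn.
have [ltj|lej] := ltnP j (s * k).
  rewrite (bigD1 (Ordinal ltj)) //= eqxx mulr1 big1 ?addr0 // => i.
  by rewrite -val_eqE /= eq_sym => /negPf->; rewrite mulr0.
rewrite nth_default ?(leq_trans lep) // big1 // => i _.
by rewrite gtn_eqF ?mulr0 // (leq_trans (ltn_ord i)).
Qed.

Lemma const_of_size_le1 (p : R) : (size (p : {poly L}) <= 1)%N -> pi p = C p`_0.
Proof. by move=> /size1_polyC pE; rewrite /quotC /skewC -pE. Qed.

(* If b had degree d > 0, then b X^(m-d) would have degree exactly m. *)
Lemma left_idealiser m b : (0 < m)%N -> (m < n * s)%N ->
  (forall y, low_degree m y -> low_degree m (b * y)) -> exists a, b = C a.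
Proof.
move=> m_gt0 ltm bS; have [p lep bE] : low_degree m b.
  by rewrite -[b]mulr1 -(expr0 X); apply/bS/low_degreeXn.
have [lep1|lt1p] := leqP (size (p : {poly L})) 1.
  by exists p`_0; rewrite bE const_of_size_le1.
pose d := (size (p : {poly L})).-1; pose q : R := p * skewX _ ^+ (m - d).
have ltd : (d < m)%N by rewrite /d -ltnS prednK // (leq_trans _ lt1p).
have d_gt0 : (0 < d)%N by rewrite /d -ltnS prednK // (leq_trans _ lt1p).
have leq : (size (q : {poly L}) <= n * s)%N.
  apply: leq_trans (size_skewMXn _ _) _; rewrite -(prednK (ltnW lt1p)) -/d.
  by rewrite addSn subnKC // ltnW.
have : low_degree m (pi q).
  by rewrite rmorphM rmorphXn /= -bE; apply/bS/low_degreeXn; rewrite ltn_subrL d_gt0.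
move=> /(low_degree_pi (ltnW ltm) leq)/leq_sizeP/(_ m (leqnn _))/eqP.
rewrite coef_skewMXn ltnNge leq_subr /= subKn ?(ltnW ltd) //.
rewrite -[_ == _]/(lead_coef (p : {poly L}) == 0) lead_coef_eq0 => /eqP p0.
by move: lt1p; rewrite p0 size_poly0.
Qed.

(** Mirror image of [left_idealiser]: powers of X on the left twist the leading coefficient, which
    stays nonzero because field morphisms are injective. *)
Lemma right_idealiser m b : (0 < m)%N -> (m < n * s)%N ->
  (forall y, low_degree m y -> low_degree m (y * b)) -> exists a, b = C a.
Proof.
move=> m_gt0 ltm bS; have [p lep bE] : low_degree m b.
  by rewrite -[b]mul1r -(expr0 X); apply/bS/low_degreeXn.
have [lep1|lt1p] := leqP (size (p : {poly L})) 1.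
  by exists p`_0; rewrite bE const_of_size_le1.
pose d := (size (p : {poly L})).-1; pose q : R := skewX _ ^+ (m - d) * p.
have ltd : (d < m)%N by rewrite /d -ltnS prednK // (leq_trans _ lt1p).
have d_gt0 : (0 < d)%N by rewrite /d -ltnS prednK // (leq_trans _ lt1p).
have leq : (size (q : {poly L}) <= n * s)%N.
  apply: leq_trans (size_skewXnM _ _) _; rewrite -(prednK (ltnW lt1p)) -/d.
  by rewrite addSn subnKC // ltnW.
have : low_degree m (pi q).
  by rewrite rmorphM rmorphXn /= -bE; apply/bS/low_degreeXn; rewrite ltn_subrL d_gt0.
move=> /(low_degree_pi (ltnW ltm) leq)/leq_sizeP/(_ m (leqnn _))/eqP.
rewrite coef_skewXnM ltnNge leq_subr /= subKn ?(ltnW ltd) // fmorph_eq0.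
rewrite -[_ == _]/(lead_coef (p : {poly L}) == 0) lead_coef_eq0 => /eqP p0.
by move: lt1p; rewrite p0 size_poly0.
Qed.

(** * Normaliser and centraliser of L *)

Hypothesis hsigma : generator 'Gal({:L} / 1%AS)%g sigma.

Lemma gal_order : #[sigma]%g = n.
Proof.
have := galois_dim (finField_galois (sub1v {:L})).
by rewrite dimv1 divn1 /order -(eqP hsigma) => ->.
Qed.

Lemma tw_fix_dvd i : (forall a, tw i a = a) -> (n %| i)%N.
Proof.
move=> fix_i; rewrite -gal_order order_dvdn; apply/gal_eqP => a _.
by rewrite gal_id -twist_gal fix_i.
Qed.

Lemma tw_surj i a : exists b, tw i b = a.
Proof.
exists (tw (i * n.-1) a).
by rewrite -twistD -mulnS prednK ?n_gt0 // mulnC tw_dimM.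
Qed.

Definition quot_cent (x : RF) := forall a, x * C a = C a * x.

(** If p is the reduced representative and i its degree, the leading coefficients of p a = b p give
    b = sigma^i(a); only i modulo n matters. *)
Lemma quot_normal x : x != 0 -> (forall a, exists b, x * C a = C b * x) ->
  exists t : 'I_n, forall a, x * C a = C (tw t a) * x.
Proof.
move=> x0 nx; have [p lep xE] := pi_reduced x.
have p0 : p != 0 by apply: contraNneq x0 => p0; rewrite xE p0 rmorph0.
pose i := (size (p : {poly L})).-1.
exists (Ordinal (ltn_pmod i n_gt0)) => a; have [b xa] := nx a.
rewrite xa; congr (C _ * x); rewrite /= tw_mod.
have pE : p * skewC _ a = skewC _ b * p.
  apply: pi_inj.
    exact: leq_trans (size_skewMC _ _) lep.
    exact: leq_trans (size_skewCM _ _) lep.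
  by rewrite !rmorphM /= -xE.
have := congr1 (fun q : R => q`_i) pE; rewrite coef_skewMC coef_skewCM mulrC.
by move/mulIf->; rewrite // -[p`_i]/(lead_coef (p : {poly L})) lead_coef_eq0.
Qed.

(** A nonzero coefficient p_j of the reduced representative satisfies p_j sigma^j(a) = a p_j for all
    a, so sigma^j = 1 and n divides j. *)
Lemma quot_centE x : quot_cent x -> exists2 p : {poly L}, (size p <= s)%N & x = evY p.
Proof.
move=> cx; have [p lep xE] := pi_reduced x.
exists (\poly_(i < s) p`_(n * i)); first exact: size_poly.
rewrite -[evY _]mulr1 -(expr0 X) evY_spread ?n_gt0 ?size_poly // xE.
congr (pi _); apply/polyP => j; rewrite coef_poly.
case: ltnP => [ltj|lej]; last by rewrite nth_default // (leq_trans lep).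
rewrite coef_poly ltn_divLR ?n_gt0 // (mulnC s) ltj.
case: eqP => [j0|jn0]; first by rewrite [in LHS](divn_eq j n) j0 addn0 mulnC.
apply/eqP; apply: contraT => pj; case: jn0; apply/eqP.
apply: tw_fix_dvd => a; have pE : p * skewC _ a = skewC _ a * p.
  apply: pi_inj.
    exact: leq_trans (size_skewMC _ _) lep.
    exact: leq_trans (size_skewCM _ _) lep.
  by rewrite !rmorphM /= -xE; apply: cx.
have := congr1 (fun q : R => q`_j) pE; rewrite coef_skewMC coef_skewCM mulrC.
by move/mulIf->.
Qed.

Lemma quot_centM x y : quot_cent x -> quot_cent y -> quot_cent (x * y).
Proof. by move=> cx cy a; rewrite -mulrA cy mulrA cx mulrA. Qed.

Lemma quotXVC i a : X ^- i * C (tw i a) = C a * X ^- i.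
Proof.
have Xi : X ^+ i \is a GRing.unit by rewrite unitrX ?quotX_unit.
by rewrite -[C (tw i a)](mulrK Xi) -quotXnC !mulrA mulVr // mul1r.
Qed.

Lemma quot_cent_conj i x : quot_cent x -> quot_cent (X ^+ i * x * X ^- i).
Proof.
move=> cx a; have [b <-] := tw_surj i a.
by rewrite -!mulrA quotXVC (mulrA x) cx !mulrA quotXnC.
Qed.

(** * Exponent classes modulo n and how a stabilising map permutes them *)

(* The number of i < s * k congruent to r modulo n. *)
Definition class_size k r := ((s * k + (n.-1 - r)) %/ n)%N.

Lemma class_sizeP k r l : (r < n)%N ->
  (l < class_size k r)%N = (n * l + r < s * k)%N.
Proof.
move=> ltr; rewrite /class_size leq_divRL ?n_gt0 //; move: n_gt0 ltr.
by nia.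
Qed.

Lemma class_size_le k r : (k < n)%N -> (r < n)%N -> (class_size k r <= s)%N.
Proof.
move=> ltk ltr; rewrite leqNgt class_sizeP // -leqNgt.
by rewrite (leq_trans _ (leq_addr _ _)) // mulnC leq_pmul2r ?deg_gt0 // ltnW.
Qed.

Lemma evY_low k r (p : {poly L}) : (k < n)%N -> (r < n)%N -> (size p <= s)%N ->
  low_degree (s * k) (evY p * X ^+ r) -> (size p <= class_size k r)%N.
Proof.
move=> ltk ltr lep; rewrite evY_spread // => /low_degree_pi; rewrite size_poly.
rewrite mulnC leq_pmul2r ?deg_gt0 // => /(_ (ltnW ltk) isT)/leq_sizeP low.
apply/leq_sizeP => j; rewrite leqNgt class_sizeP // -leqNgt => lej.
have [ltj|] := ltnP j s; last by move/(leq_trans lep)/(nth_default 0).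
have := low (n * j + r)%N; rewrite mulnC => /(_ lej).
rewrite coef_poly mulnC modnMDl divnMDl ?n_gt0 // modn_small // divn_small //.
by rewrite addn0 eqxx; case: ltnP => //; nia.
Qed.

(** Multiply p by Y one step at a time: as long as the product has size at most [class_size k r] <
    s, the next one has size at most s and is still reduced, so its membership in the code bounds
    its degree again. No reduction modulo F ever occurs. *)
Lemma evY_low_stable k r d (p : {poly L}) : (k < n)%N -> (r < n)%N -> (size p <= s)%N ->
  p != 0 -> (0 < d)%N -> (class_size k r < s)%N ->
  (forall l, (l < d)%N -> low_degree (s * k) (evY p * X ^+ (n * l + r))) ->
  (size p + d <= (class_size k r).+1)%N.
Proof.
move=> ltk ltr lep p0 + lts low; case: d low => // d low _.
rewrite addnS ltnS; have: (d < d.+1)%N by [].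
move: {1 3}d => l; elim: l => [|l IHl] ltl.
  by rewrite addn0 (@evY_low k r) //; have := low 0%N ltl; rewrite muln0.
rewrite addnC -size_mulXn // (@evY_low k r) //.
  rewrite size_mulXn // addnC addnS.
  by apply: leq_ltn_trans lts; apply/IHl/ltnW.
by rewrite rmorphM rmorphXn /= evYX -mulrA -exprM -exprD; apply: low.
Qed.

Lemma quotXn_powC i (x : RF) : x * Y ^+ i = Y ^+ i * x.
Proof. by apply: commrX; rewrite /GRing.comm quotXn_center. Qed.

Lemma quotX_expE j : X ^+ j = X ^+ (j %% n) * Y ^+ (j %/ n).
Proof. by rewrite -exprM -exprD mulnC addnC -divn_eq. Qed.

(* W := u (X^j v X^-j) Y^(j / n) centralises L, and left multiplication by it *)
(* maps the part of the code in degrees congruent to r modulo n into the part *)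
(* in degrees congruent to r + m; compare degrees in Y.                       *)
Lemma code_shift k m r (u v : RF) : (k < n)%N -> (r < n)%N ->
    u \is a GRing.unit -> v \is a GRing.unit -> quot_cent u -> quot_cent v ->
    (forall x, low_degree (s * k) x -> low_degree (s * k) (u * x * (X ^+ m * v))) ->
    let j := (r + m)%N in
  (class_size k r <= class_size k (j %% n))%N /\
  ((0 < class_size k r)%N -> (class_size k (j %% n) < s)%N ->
   class_size k r = class_size k (j %% n) ->
   exists2 c : L, c != 0 & u * X ^+ j * v * Y ^+ (j %/ n) = C c * X ^+ j).
Proof.
move=> ltk ltr Uu Uv cu cv uSv j.
pose W := u * (X ^+ j * v * X ^- j) * Y ^+ (j %/ n).
have UX i : X ^+ i \is a GRing.unit by rewrite unitrX ?quotX_unit.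
have unitrM_unit (a b : RF) : a \is a GRing.unit -> b \is a GRing.unit ->
    a * b \is a GRing.unit by move=> Ua Ub; rewrite unitrMl.
have UW : W \is a GRing.unit.
  by rewrite /W !unitrM_unit ?unitrV ?UX // unitrX ?UX.
have cW : quot_cent W.
  apply: quot_centM; first by apply: quot_centM => //; apply: quot_cent_conj.
  by move=> a; rewrite quotXn_powC.
have [p lep WE] := quot_centE cW.
have p0 : p != 0.
  by apply: contraTneq UW => p0; rewrite WE p0 rmorph0 unitr0.
have lt_jn : (j %% n < n)%N by rewrite ltn_pmod ?n_gt0.
have WX : W * X ^+ (j %% n) = u * X ^+ j * v.
  rewrite /W -mulrA -quotXn_powC -quotX_expE -!mulrA; congr (_ * (_ * _)).
  by rewrite mulVr ?mulr1.
have low l : (l < class_size k r)%N ->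
    low_degree (s * k) (evY p * X ^+ (n * l + j %% n)).
  rewrite class_sizeP // => ltl; rewrite -WE addnC exprD mulrA WX exprM.
  have -> : u * X ^+ j * v * Y ^+ l = u * X ^+ (n * l + r) * (X ^+ m * v).
    rewrite quotXn_powC [X ^+ (n * l + r)]exprD exprM (mulrA u) (quotXn_powC l u).
    by rewrite /j exprD -!mulrA.
  exact/uSv/low_degreeXn.
have [d0|d_gt0] := posnP (class_size k r); first by rewrite d0.
(* A full target class makes the inequality trivial and contradicts the hypothesis of the second
   claim. *)
have [lts|les] := ltnP (class_size k (j %% n)) s; last first.
  by split=> //; apply: leq_trans les; apply: class_size_le.
have := evY_low_stable ltk lt_jn lep p0 d_gt0 lts low.
have szp : (0 < size p)%N by rewrite size_poly_gt0.
move=> szpd; split=> [|_ _ eq_d]; first lia.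
have /size1_polyC pE : (size p <= 1)%N by lia.
exists p`_0; first by rewrite -polyC_eq0 -pE.
have <- : W = C p`_0 by rewrite -evYC -pE.
by rewrite -WX -mulrA -quotX_expE.
Qed.

(** * Relations over L satisfied by Y, and norm equations *)

Lemma evY_eq0 (p : {poly L}) : evY p = 0 -> FL %| p.
Proof.
move=> p0; have FL0 : FL != 0 by rewrite -size_poly_gt0 size_FL size_gt0.
have szr : (size (p %% FL)%R <= s)%N.
  by rewrite -ltnS prednK ?size_gt0 // -size_FL ltn_modp.
have r0 : evY (p %% FL) = 0.
  move: p0; rewrite {1}(divp_eq p FL) rmorphD rmorphM /= evY_F mulr0 add0r.
  by [].
(* Zero is the only element of low degree for k = 0, so [evY_low] bounds the size of the remainder
   by [class_size 0 0], which is 0. *)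
have low0 : low_degree (s * 0) (evY (p %% FL) * X ^+ 0).
  by rewrite r0 mul0r muln0; exists 0; rewrite ?size_poly0 ?rmorph0.
apply/modp_eq0P/eqP; rewrite -size_poly_leq0.
have := evY_low n_gt0 n_gt0 szr low0.
by rewrite /class_size muln0 add0n subn0 divn_small // prednK ?n_gt0.
Qed.

Lemma prod_twist z : \prod_(j < n) tw j z = galNorm 1 {:L} z.
Proof.
pose h (j : 'I_n) := (sigma ^+ j)%g.
have inj_h : injective h.
  move=> i j /eqP; rewrite eq_expg_mod_order gal_order !modn_small // => /eqP.
  exact: val_inj.
rewrite /galNorm (eqP hsigma).
have -> : <[sigma]>%g = h @: [set: 'I_n].
  apply/esym/eqP; rewrite eqEcard card_imset // cardsT card_ord.
  rewrite -[X in (X <= _)%N]/(#[sigma]%g) gal_order leqnn andbT.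
  apply/fintype.subsetP => _ /imsetP[j _ ->].
  exact: mem_cycle.
rewrite big_imset /=; last by move=> i j _ _; apply: inj_h.
by apply: eq_big => j; [rewrite finset.in_setT | rewrite twist_gal].
Qed.

(** Eliminate u between the two relations; it commutes with scalars, so the quotient c'/c can be
    moved past u and then past X^i, where it becomes z = sigma^-i(c'/c). *)
Lemma semilinear_step (u w w' : RF) c c' i : u \is a GRing.unit -> c != 0 -> c' != 0 ->
    u * X ^+ i * w = C c * X ^+ i -> u * X ^+ i.+1 * w' = C c' * X ^+ i.+1 ->
    quot_cent u ->
  exists2 z : L, z != 0 & X * w' = C z * w * X.
Proof.
move=> Uu c0 c'0 uw uw' cu; have [z zE] := tw_surj i (c' / c).
exists z.
  by rewrite -(fmorph_eq0 (twist (gal_rmorph sigma) i)) /= zE mulf_neq0 ?invr_eq0.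
have UX : X ^+ i \is a GRing.unit by rewrite unitrX ?quotX_unit.
apply: (mulrI UX); apply: (mulrI Uu).
rewrite !mulrA -[u * X ^+ i * X]mulrA -exprSr uw' -[u * X ^+ i * C z]mulrA.
rewrite quotXnC zE mulrA cu -!mulrA (mulrA (X ^+ i)) (mulrA u) (mulrA u) uw.
by rewrite mulrA mulrA -rmorphM divfK // exprSr mulrA.
Qed.

(** Moving X across v n times collects the product of the conjugates of z and q^n; as X^n is central
    and v a unit, the collected factor must be 1. *)
Lemma semilinear_norm (v q : RF) z : v \is a GRing.unit -> X * v = C z * v * X * q ->
  quot_center sigma hF q -> C (\prod_(j < n) tw j z) * q ^+ n = 1.
Proof.
move=> Uv Xv cq.
have Xiv i : X ^+ i * v = C (\prod_(j < i) tw j z) * v * X ^+ i * q ^+ i.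
  elim: i => [|i IHi]; first by rewrite big_ord0 rmorph1 !expr0 !mul1r !mulr1.
  have -> : \prod_(j < i.+1) tw j z = gal_rmorph sigma (\prod_(j < i) tw j z) * z.
    rewrite big_ord_recl mulrC rmorph_prod; congr (_ * _).
  rewrite rmorphM [X ^+ i.+1]exprS [q ^+ i.+1]exprS -(mulrA X) IHi !mulrA quotXC.
  by rewrite -(mulrA (C _) X v) Xv !mulrA -(mulrA _ q (X ^+ i)) cq !mulrA.
have vY : v * Y = Y * v by rewrite quotXn_center.
have UY : Y * v \is a GRing.unit by rewrite -vY unitrMl ?unitrX ?quotX_unit.
have qn : GRing.comm (Y * v) (q ^+ n) by apply: commrX; rewrite /GRing.comm cq.
apply: (mulIr UY); rewrite mul1r [RHS]Xiv -(mulrA (C _) (q ^+ n)) -qn !mulrA.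
by rewrite -(mulrA _ Y v) -vY mulrA.
Qed.

(** 1 and Y are independent over L, since a linear relation would be divisible by F, of degree at
    least 2. *)
Lemma quotCY_neq_quotC z z' : z != 0 -> C z * Y != C z'.
Proof.
move=> z0; apply/eqP => zY.
have := @evY_eq0 (z *: 'X - z'%:P).
rewrite rmorphB -mul_polyC rmorphM /= !evYC evYX zY subrr => /(_ erefl).
have sz2 : size (z%:P * 'X - z'%:P : {poly L})%R = 2%N.
  by rewrite -polyCN size_MXaddC polyC_eq0 (negPf z0) size_polyC z0.
move/dvdp_leq; rewrite -size_poly_gt0 sz2 size_FL => /(_ isT).
by move: s_gt1; lia.
Qed.

Lemma quotX2_const (b : K) : n = 2%N -> Y ^+ 2 = C b%:A -> F = 'X^2 - b%:P.
Proof.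
move=> n2 Y2; set P := 'X^2 - b%:P.
have szP : size P = 3%N by rewrite size_XnsubC.
have monP : P \is monic by rewrite monicXnsubC.
have : FL %| map_poly (in_alg L) P.
  apply: evY_eq0; rewrite rmorphB /= map_polyXn map_polyC rmorphB rmorphXn /=.
  by rewrite evYX evYC Y2 subrr.
rewrite dvdp_map => dvdF.
have monF := hF.2; apply/eqP; rewrite -eqp_monic // -dvdp_size_eqp //.
rewrite eqn_leq dvdp_leq ?monic_neq0 //= szP.
by rewrite -ltn_predRL.
Qed.

Lemma class_size_anti k r r' : (r <= r')%N -> (class_size k r' <= class_size k r)%N.
Proof. by move=> le_r; apply: leq_div2r; rewrite leq_add2l leq_sub2l. Qed.

(** * Determination of m, u and v *)

Section Core.
Variables (k m : nat) (u v : RF).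
Hypotheses (k_gt0 : (0 < k)%N) (k_ltn : (k < n)%N) (m_ltn : (m < n)%N).
Hypotheses (Uu : u \is a GRing.unit) (Uv : v \is a GRing.unit).
Hypotheses (cu : quot_cent u) (cv : quot_cent v).
Hypothesis uSv : forall x,
  low_degree (s * k) x -> low_degree (s * k) (u * x * (X ^+ m * v)).

Local Notation cs := (class_size k).

Lemma cs0_gt0 : (0 < cs 0)%N.
Proof. by rewrite class_sizeP ?n_gt0 // muln0 muln_gt0 deg_gt0 k_gt0. Qed.

(** The exponent n (s - 1) + (n - 1) = n s - 1 is not below s k, as k < n. *)
Lemma cs_last_lt : (cs n.-1 < s)%N.
Proof.
rewrite ltnNge -(prednK deg_gt0) class_sizeP; last by rewrite prednK ?n_gt0.
by move: n_gt0 deg_gt0 k_ltn; nia.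
Qed.

(** Class sizes decrease with r but do not decrease under r -> r + m modulo n. For r < m this gives
    cs 0 <= cs m <= cs r, and steps of length m reach the remaining r; no coprimality of m and n
    enters. *)
Lemma cs_shift_const r : (0 < m)%N -> (r < n)%N -> cs r = cs 0.
Proof.
move=> m_gt0; have shift r' ltr := (code_shift k_ltn ltr Uu Uv cu cv uSv (r := r')).1.
have ge0 r' : (r' < n)%N -> (cs 0 <= cs r')%N.
  elim/ltn_ind: r' => r' IHr ltr; have [ltm|lem] := ltnP r' m.
    apply: leq_trans (class_size_anti _ (ltnW ltm)).
    by have := shift 0%N n_gt0; rewrite add0n modn_small.
  have lt_n : (r' - m < n)%N by apply: leq_ltn_trans ltr; apply: leq_subr.
  apply: leq_trans (IHr (r' - m)%N _ lt_n) _.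
    by rewrite ltn_subrL m_gt0 (leq_trans m_gt0).
  by have := shift _ lt_n; rewrite subnK // modn_small.
by move=> ltr; apply/eqP; rewrite eqn_leq ge0 // class_size_anti.
Qed.

Hypothesis hexc : forall nu : K, nu != 0 -> n = 2%N -> F <> 'X^2 - nu%:P.

Lemma shift_eq0 : m = 0%N.
Proof.
have [-> //|m_gt0] := posnP m; exfalso.
have Wc r : (r < n)%N -> exists2 c : L, c != 0 &
    u * X ^+ (r + m) * v * Y ^+ ((r + m) %/ n) = C c * X ^+ (r + m).
  move=> ltr; have lt_rm : ((r + m) %% n < n)%N by rewrite ltn_pmod ?n_gt0.
  have [_] := code_shift k_ltn ltr Uu Uv cu cv uSv; rewrite !cs_shift_const //.
  apply=> //; first exact: cs0_gt0.
  by rewrite -(cs_shift_const (r := n.-1)) ?cs_last_lt // prednK ?n_gt0.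
have UY : Y \is a GRing.unit by rewrite unitrX ?quotX_unit.
(* Residues r >= m are reached without wrapping around modulo n; those below m, in [lo], wrap once
   and pick up a factor Y. *)
have hi r : (m <= r)%N -> (r < n)%N ->
    exists2 c : L, c != 0 & u * X ^+ r * v = C c * X ^+ r.
  move=> lemr ltr; have [|c c0] := Wc (r - m)%N.
    by apply: leq_ltn_trans ltr; apply: leq_subr.
  by rewrite subnK // divn_small // mulr1; exists c.
have lo r : (r < m)%N -> exists2 c : L, c != 0 & u * X ^+ r * (v * Y) = C c * X ^+ r.
  move=> ltrm; have [|c c0 cE] := Wc (r + n - m)%N.
    by rewrite ltn_subLR; lia.
  exists c => //; move: cE; have -> : (r + n - m + m = r + n)%N by lia.
  rewrite divnDr // divnn n_gt0 divn_small ?(ltn_trans ltrm) // expr1 exprD.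
  move=> cE; apply: (mulIr UY); rewrite -[RHS]mulrA -cE !mulrA.
  by rewrite -(mulrA (u * X ^+ r) v Y) -(quotXn_center v) mulrA.
have lt_m1 : (m.-1 < m)%N by rewrite prednK.
have [c1 c1_0 c1E] := lo m.-1 lt_m1.
have [c2 c2_0 c2E] := hi m (leqnn m) m_ltn.
(* Compare the last wrapped residue m - 1 with the first unwrapped one, m. *)
have {c1 c1_0 c1E c2 c2_0 c2E} [z z0 zE] :
    exists2 z : L, z != 0 & X * v = C z * (v * Y) * X.
  apply: (semilinear_step Uu c1_0 c2_0 c1E _ cu); by rewrite prednK.
(* For n = 2 the norm equation reads N(z) Y^2 = 1 with N(z) in K, so F is Y^2 - N(z)^-1. *)
have [n2|n_gt2] : n = 2%N \/ (2 < n)%N by lia.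
  have Xv : X * v = C z * v * X * Y by rewrite zE -!mulrA -(quotXn_center X).
  have := semilinear_norm Uv Xv quotXn_center; rewrite prod_twist => NY.
  have /vlineP [b bE] : galNorm 1 {:L} z \in 1%VS.
    by apply: mem_galNorm; rewrite ?memvf // finField_galois ?sub1v.
  have Nz0 : galNorm 1 {:L} z != 0 by rewrite galNorm_eq0.
  have b0 : b != 0 by apply: contraNneq Nz0 => b0; rewrite bE b0 scale0r.
  apply: (hexc (nu := b^-1)) => //; first by rewrite invr_eq0.
  apply: quotX2_const => //; rewrite -n2.
  have UN := quotC_unit Nz0; apply: (mulrI UN); rewrite NY.
  by rewrite bE -rmorphM -scalerAl mul1r scalerA divff // scale1r rmorph1.
(* With n > 2, one side of m contains two adjacent residues: m and m + 1, or m - 2 and m - 1 when m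
   = n - 1. The factor Y cancels in the second case. *)
have [z' z'0 z'E] : exists2 z' : L, z' != 0 & X * v = C z' * v * X.
  have [lt_mn|le_nm] := ltnP m.+1 n.
    have [c1 c1_0 c1E] := hi m (leqnn m) m_ltn.
    have [c2 c2_0 c2E] := hi m.+1 (leqnSn m) lt_mn.
    exact: (semilinear_step Uu c1_0 c2_0 c1E c2E cu).
  have lt_m2 : (m.-2 < m)%N by lia.
  have [c1 c1_0 c1E] := lo m.-2 lt_m2.
  have [c2 c2_0 c2E] := lo m.-1 lt_m1.
  have [|z' z'0 z'E] := semilinear_step Uu c1_0 c2_0 c1E (w' := v * Y) (c' := c2) _ cu.
    by have -> : m.-2.+1 = m.-1 by lia.
  exists z' => //; apply: (mulIr UY); rewrite -(mulrA X) z'E -!mulrA.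
  by rewrite (quotXn_center X).
have /negP[] := quotCY_neq_quotC z' z0; apply/eqP.
apply: (mulIr Uv); apply: (mulIr quotX_unit); rewrite -z'E zE -!mulrA.
by rewrite (mulrA Y) quotXn_center -!mulrA.
Qed.

Lemma core_form : exists e a c,
  [/\ quot_center sigma hF e, e \is a GRing.unit, a != 0, c != 0 &
      v = e * C a /\ u = e^-1 * C c].
Proof.
have n_ge2 : (1 < n)%N by lia.
(* Two adjacent classes must be neither empty nor full. If class 0 is not full, take 0 and 1, since
   1 < s k. Otherwise take n - 2 and n - 1: there s k > n (s - 1) >= n, while s k <= n s - s <= n s
   - 2; both cases use s >= 2. *)
have [r [lt_r1 [cs0 css]]] : exists r, (r.+1 < n)%N /\ (0 < cs r.+1)%N /\ (cs r < s)%N.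
  have [lts|les] := ltnP (cs 0) s.
    exists 0%N; split=> //; split=> //.
    by rewrite class_sizeP // muln0 add0n; nia.
  exists n.-2; have -> : n.-2.+1 = n.-1 by lia.
  split; first lia; move: les; rewrite -(prednK deg_gt0) class_sizeP ?n_gt0 // => les.
  split; first by rewrite class_sizeP; nia.
  rewrite prednK ?deg_gt0 // ltnNge -(prednK deg_gt0) class_sizeP; last lia.
  nia.
have Wc i : (i < n)%N -> (0 < cs i)%N -> (cs i < s)%N ->
    exists2 c : L, c != 0 & u * X ^+ i * v = C c * X ^+ i.
  move=> lti i0 ils; have [_] := code_shift k_ltn lti Uu Uv cu cv uSv.
  by rewrite shift_eq0 addn0 modn_small // divn_small // mulr1; apply.
have le_r := class_size_anti k (leqnSn r).
have [c1 c1_0 c1E] := Wc r (ltnW lt_r1) (leq_trans cs0 le_r) css.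
have [c2 c2_0 c2E] := Wc _ lt_r1 cs0 (leq_ltn_trans le_r css).
have [z z0 zE] := semilinear_step Uu c1_0 c2_0 c1E c2E cu.
have Xv : X * v = C z * v * X * 1 by rewrite mulr1.
have := semilinear_norm Uv Xv (fun x => esym (commr1 x)).
rewrite prod_twist expr1n mulr1 -(rmorph1 C) => /quotC_inj/eqP.
(* Hilbert 90 writes z = b / sigma(b); then X v b = z v sigma(b) X = v b X, so v b commutes with X
   as well as with L and is central. *)
move/(Hilbert's_theorem_90 hsigma (memvf z)) => [b [_ b0] zb].
have Ub := quotC_unit b0; exists (v * C b), b^-1, (c1 / tw r b^-1).
have ce : quot_center sigma hF (v * C b).
  apply: quot_centerP => [a|].
    by rewrite cv -(mulrA (C b)) (cv a) !mulrA -!rmorphM mulrC.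
  rewrite (mulrA X) zE -(mulrA _ X (C b)) quotXC (mulrA (C z * v)).
  rewrite -(mulrA (C z) v) (cv (sigma b)) mulrA -rmorphM zb.
  by rewrite divfK ?fmorph_eq0 // cv.
have Ue : v * C b \is a GRing.unit by rewrite unitrMl.
have b'0 : b^-1 != 0 by rewrite invr_eq0.
have tb0 : tw r b^-1 != 0 by rewrite fmorph_eq0.
have vE : v = v * C b * C b^-1 by rewrite -mulrA -rmorphM divff // rmorph1 mulr1.
split=> //; first by rewrite mulf_neq0 ?invr_eq0.
split=> //; apply: (mulrI Ue); rewrite mulVKr // ce.
have UX : X ^+ r \is a GRing.unit by rewrite unitrX ?quotX_unit.
apply: (mulIr (quotC_unit tb0)); apply: (mulIr UX); rewrite -rmorphM divfK //.
rewrite -c1E {2}vE; set e := v * C b in ce *.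
by rewrite -(mulrA (u * e)) -quotXnC -(mulrA u e) (mulrA e) ce -!mulrA.
Qed.
End Core.

(** * Conjugation by powers of X, and the inclusion of the monomial pairs *)

Lemma quotXn_pi i (p : R) : X ^+ i * pi p = pi (map_poly (tw i) p) * X ^+ i.
Proof.
rewrite /quotX -rmorphXn -!rmorphM; congr (pi _); apply/polyP => j.
by rewrite coef_skewXnM coef_skewMXn coef_map.
Qed.

Lemma quotXn_unit i : X ^+ i \is a GRing.unit.
Proof. by rewrite unitrX ?quotX_unit. Qed.

Lemma low_degree_conj m i x : low_degree m x -> low_degree m (X ^+ i * x * X ^- i).
Proof.
case=> p lep ->; exists (map_poly (tw i) p); first by rewrite size_map_poly.
by rewrite quotXn_pi mulrK ?quotXn_unit.
Qed.

Lemma low_degree_conjV m i x : low_degree m x -> low_degree m (X ^- i * x * X ^+ i).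
Proof.
case=> p lep ->; exists (map_poly (tw (i * n.-1)) p); first by rewrite size_map_poly.
have {1}-> : p = map_poly (tw i) (map_poly (tw (i * n.-1)) p).
  apply/polyP => j; rewrite !coef_map /= -twistD -mulnS prednK ?n_gt0 //.
  by rewrite mulnC tw_dimM.
by rewrite -mulrA -quotXn_pi mulKr ?quotXn_unit.
Qed.

Lemma quot_centerV c : quot_center sigma hF c -> quot_center sigma hF c^-1.
Proof. by move=> cc x; apply/esym/commrV; rewrite /GRing.comm cc. Qed.

Lemma linear_autP m g h :
  linear_aut [set x | low_degree m x]%classic (g, h) <->
  [/\ g \is a GRing.unit, h \is a GRing.unit,
      forall x, low_degree m x -> low_degree m (g * x * h)
    & forall y, low_degree m y -> low_degree m (g^-1 * y * h^-1)].
Proof.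
split=> [[/= Ug Uh S]|[Ug Uh gSh gShV]]; split=> //=.
- move=> x Sx; suff : [set x | low_degree m x]%classic (g * x * h) by [].
  by rewrite -S; exists x.
- move=> y Sy; have : [set x | low_degree m x]%classic y by [].
  by rewrite -{1}S => -[x Sx <-]; rewrite mulrA mulrK // mulKr.
- apply/seteqP; split=> [_ [x Sx <-]|y Sy]; first exact: gSh.
  exists (g^-1 * y * h^-1); first exact: gShV.
  by rewrite !mulrA divrr // mul1r divrK.
Qed.

(** The central factor of g cancels in g x g^-1, leaving conjugation by a scalar and by X^t; both
    act on coefficients only and keep the degree. *)
Lemma monomial_linear_aut m gh : monomial_aut sigma hF gh ->
  linear_aut [set x | low_degree m x]%classic gh.
Proof.
case=> g [a [[c [b [t [cc Uc b0 gE]]]] a0 ->]].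
have Ub := quotC_unit b0; have Ua := quotC_unit a0; have UX := quotXn_unit t.
have Ug : g \is a GRing.unit by rewrite gE unitrMl // unitrMl.
have CbV x : C b^-1 * (C b * x) = x.
  by rewrite mulrA -rmorphM mulVf // rmorph1 mul1r.
have CVb x : C b * (C b^-1 * x) = x.
  by rewrite mulrA -rmorphM divff // rmorph1 mul1r.
have gconj x : g * x * g^-1 = C b * (X ^+ t * x * X ^- t) * C b^-1.
  apply: (mulIr Ug); rewrite divrK //.
  have Cg : C b^-1 * g = c * X ^+ t.
    by rewrite gE -!mulrA (mulrA (C b^-1) c) -cc -mulrA CbV.
  by rewrite -[RHS]mulrA Cg (mulrA _ c) -cc gE !mulrA divrK.
have gconjV y : g^-1 * y * g = X ^- t * (C b^-1 * y * C b) * X ^+ t.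
  apply: (mulrI Ug); rewrite !mulrA divrr // mul1r.
  have gX : g * X ^- t = c * C b by rewrite gE mulrK.
  rewrite gX -(mulrA c) -rmorphM divff // rmorph1 mulr1.
  by rewrite gE !mulrA -cc.
apply/linear_autP; split=> // [|x Sx|y Sy]; first by rewrite unitrMl // unitrV.
  rewrite mulrA gconj.
  by do 2!apply: low_degreeMC; apply: low_degreeCM; apply: low_degree_conj.
rewrite invrM ?unitrV // invrK -fmorphV mulrA -(mulrA _ y) gconjV.
by apply/low_degree_conjV/low_degreeMC/low_degreeCM/low_degreeMC.
Qed.

(** * Every stabilising pair is monomial *)

Section Stabiliser.
Variables (k : nat) (g h : RF).
Hypotheses (k_gt0 : (0 < k)%N) (k_ltn : (k < n)%N).
Hypothesis hexc : forall nu : K, nu != 0 -> n = 2%N -> F <> 'X^2 - nu%:P.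
Hypotheses (Ug : g \is a GRing.unit) (Uh : h \is a GRing.unit).
Hypothesis gSh : forall x, low_degree (s * k) x -> low_degree (s * k) (g * x * h).
Hypothesis gShV : forall y,
  low_degree (s * k) y -> low_degree (s * k) (g^-1 * y * h^-1).

Lemma sk_gt0 : (0 < s * k)%N.
Proof. by rewrite muln_gt0 deg_gt0. Qed.

Lemma sk_lt : (s * k < n * s)%N.
Proof. by rewrite mulnC ltn_pmul2r ?deg_gt0. Qed.

Lemma unit_neq0 (x : RF) : x \is a GRing.unit -> x != 0.
Proof. by apply: contraTneq => ->; rewrite unitr0. Qed.

(** Conjugating scalar multiplication by the bijection x -> g x h of the code shows that g a g^-1
    lies in the left idealiser, hence in L. *)
Lemma stab_left_normal a : exists b, g * C a = C b * g.
Proof.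
have [|b bE] := @left_idealiser _ (g * C a * g^-1) sk_gt0 sk_lt; last first.
  by exists b; rewrite -bE divrK.
move=> y Sy; have -> : g * C a * g^-1 * y = g * (C a * (g^-1 * y * h^-1)) * h.
  by rewrite !mulrA divrK.
by apply/gSh/low_degreeCM/gShV.
Qed.

Lemma stab_right_normal a : exists b, C a * h = h * C b.
Proof.
have [|b bE] := @right_idealiser _ (h^-1 * C a * h) sk_gt0 sk_lt; last first.
  by exists b; rewrite -bE !mulrA divrr // mul1r.
move=> y Sy; have -> : y * (h^-1 * C a * h) = g * ((g^-1 * y * h^-1) * C a) * h.
  by rewrite !mulrA divrr // mul1r.
by apply/gSh/low_degreeMC/gShV.
Qed.

Lemma stab_monomial : monomial_aut sigma hF (g, h).
Proof.
have [t gC] := quot_normal (unit_neq0 Ug) stab_left_normal.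
have [u uE0] : exists u, u = X ^- t * g by eexists.
(* With X^-t split off g, putting X^t on h makes u x w the conjugate X^-t (g x h) X^t, which is
   still in the code. *)
have [w wE0] : exists w, w = h * X ^+ t by eexists.
have Uu : u \is a GRing.unit by rewrite uE0 unitrMl // unitrV quotXn_unit.
have Uw : w \is a GRing.unit by rewrite wE0 unitrMl // quotXn_unit.
have cu : quot_cent u by move=> a; rewrite uE0 -mulrA gC mulrA quotXVC mulrA.
have Uw' : w^-1 \is a GRing.unit by rewrite unitrV.
have nw a : exists b, w^-1 * C a = C b * w^-1.
  have [b hb] := stab_right_normal a; have [b' bE] := tw_surj t b.
  exists b'; apply: (mulrI Uw); apply: (mulIr Uw).
  rewrite !mulrA divrr // mul1r divrK // wE0.
  by rewrite -(mulrA h) quotXnC bE mulrA -hb mulrA.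
have [t' wC] := quot_normal (unit_neq0 Uw') nw.
have Cw a : C a * w = w * C (tw t' a).
  apply: (mulIr Uw').
  by rewrite mulrK // -mulrA -wC mulrA divrr // mul1r.
(* w^-1 acts on L as sigma^t', so w acts as sigma^m and X^-m w centralises L. The reduction modulo n
   covers t' = 0. *)
pose m := ((n - t') %% n)%N; have [v vE0] : exists v, v = X ^- m * w by eexists.
have twm a : tw m (tw t' a) = a.
  by rewrite tw_mod -twistD subnK ?twist_dim // ltnW.
have cv : quot_cent v.
  move=> a; have [b <-] := tw_surj t' a.
  by rewrite vE0 -mulrA -Cw mulrA -{1}(twm b) quotXVC mulrA.
have UX := quotXn_unit.
have Uv : v \is a GRing.unit by rewrite vE0 unitrMl // unitrV UX.
have wE : w = X ^+ m * v by rewrite vE0 mulVKr ?UX.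
have uSv x : low_degree (s * k) x -> low_degree (s * k) (u * x * (X ^+ m * v)).
  move=> Sx; have -> : u * x * (X ^+ m * v) = X ^- t * (g * x * h) * X ^+ t.
    by rewrite -wE uE0 wE0 !mulrA.
  exact/low_degree_conjV/gSh.
have m_ltn : (m < n)%N by rewrite ltn_pmod ?n_gt0.
have m0 := shift_eq0 k_gt0 k_ltn m_ltn Uu Uv cu cv uSv hexc.
have [e [a [c [ce Ue a0 c0 [vE uE]]]]] :=
  core_form k_gt0 k_ltn m_ltn Uu Uv cu cv uSv hexc.
have gE : g = e^-1 * C (tw t c) * X ^+ t.
  rewrite -mulrA -quotXnC mulrA (quot_centerV ce) -mulrA -uE.
  by rewrite uE0 mulVKr ?UX.
have hE : h = e * C a * X ^- t.
  apply: (mulIr (UX t)); rewrite divrK ?UX // -vE -[v]mul1r -(expr0 X) -m0.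
  by rewrite -wE wE0.
have tc0 : tw t c != 0 by rewrite fmorph_eq0.
exists g, (tw t (c * a)); split; last 1 first.
- congr (_, _); apply: (mulrI Ug); rewrite mulVKr //.
  rewrite gE hE -(mulrA e) (mulrA _ e) -ce -!mulrA mulVKr //.
  by rewrite (mulrA (X ^+ t)) quotXnC mulrK ?UX // -!rmorphM.
- exists e^-1, (tw t c), t; split=> //; first exact: quot_centerV.
  by rewrite unitrV.
- by rewrite fmorph_eq0 mulf_neq0.
Qed.
End Stabiliser.

Theorem linear_aut_skew_code k :
  (0 < k)%N -> (k < n)%N ->
  (forall nu : K, nu != 0 -> n = 2%N -> F <> 'X^2 - nu%:P) ->
  linear_aut (skew_code sigma hF k) = monomial_aut sigma hF.
Proof.
move=> k_gt0 k_ltn hexc.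
have -> : skew_code sigma hF k = [set x | low_degree (s * k) x]%classic.
  by apply/seteqP; split=> x /skew_codeP.
apply/seteqP; split=> [[g h]|gh]; last exact: monomial_linear_aut.
by move=> /linear_autP[Ug Uh gSh gShV]; apply: stab_monomial gSh gShV.
Qed.

End SkewQuotientTheory.

Theorem theorem6p5 (K : finFieldType) (L : splittingFieldType K)
  (n s k : nat) (sigma : gal_of {:L}) (F : {poly K})
  (hF : monic_irreducible_poly F)
  (hn : \dim {:L} = n) (n_ge2 : (2 <= n)%N)
  (hs : size F = s.+1) (s_ge2 : (2 <= s)%N)
  (hk : (1 <= k <= n - 1)%N)
  (hsigma : generator 'Gal({:L} / 1%AS)%g sigma)
  (hexc : forall nu : K, nu != 0 -> (n, s, F) <> (2%N, 2%N, 'X^2 - nu%:P)) :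
  linear_aut (skew_code sigma hF k) = monomial_aut sigma hF.
Proof.
case/andP: hk => k_gt0 k_le; apply: linear_aut_skew_code => //.
- by rewrite hs.
- by rewrite hn; lia.
(* The equation F = Y^2 - nu already forces s = 2, so the triple is the excluded one. *)
- rewrite hn => nu nu0 n2 FE; apply: (hexc nu nu0); rewrite n2 FE; congr (_, _, _).
  by apply: succn_inj; rewrite -hs FE size_XnsubC.
Qed.
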